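(* Let $G$ be a perfect graph on the vertex set $V(G)=\{1,\dots,d\}$ with exactly $n+1$ maximal cliques $Q_0,Q_1,\dots,Q_n$. Define $$\mathcal{C}(G)=\Big\{(z_1,\dots,z_n)\in\mathbb{R}^n : -|J|+\sum_{v\in X_{IJ}^-}m_{IJ}(v)+1\le\sum_{i\in I}z_i-\sum_{j\in J}z_j\le |I|+\sum_{v\in X_{IJ}^+}m_{IJ}(v)-1\Big\},$$ where the inequalities range over all nonempty finite multisets $I,J$ of elements of $\{0,1,\dots,n\}$ with $|I|=|J|$ and $I\cap J=\emptyset$, and $z_0=0$. Then the conic divisorial ideals of the stable set ring $\Bbbk[\mathrm{Stab}_G]$ (up to isomorphism) correspond one-to-one to the points of $\mathcal{C}(G)\cap\mathbb{Z}^n$: the map sending $z=(z_1,\dots,z_n)$ to the isomorphism class of $T(\mathbf a)$ with $\mathbf a=(a_0,\dots,a_{n+d})=(0,z_1,\dots,z_n,0,\dots,0)$ is a bijection from $\mathcal{C}(G)\cap\mathbb{Z}^n$ onto the set of isomorphism classes of conic divisorial ideals of $\Bbbk[\mathrm{Stab}_G]$.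
   Context: $\Bbbk$ is an algebraically closed field of characteristic $0$. Toric rings and conic divisorial ideals. Let $\tau\subset\mathbb{R}^D$ be a $D$-dimensional strongly convex rational polyhedral cone with minimal system of primitive generators $v_1,\dots,v_N\in\mathbb{Z}^D$, put $\sigma_i(\mathbf x)=\langle \mathbf x,v_i\rangle$, $\sigma=(\sigma_1,\dots,\sigma_N)$, $\tau^\vee=\{\mathbf x\in\mathbb{R}^D:\sigma_i(\mathbf x)\ge 0\ \forall i\}$ and $R=\Bbbk[\tau^\vee\cap\mathbb{Z}^D]$. For $\mathbf a\in\mathbb{R}^N$, $T(\mathbf a)$ is the $R$-module generated by the Laurent monomials with exponent vector in $\{\mathbf x\in\mathbb{Z}^D:\sigma_i(\mathbf x)\ge a_i\ \forall i\}$; these are exactly the divisorial ideals of $R$. For $\mathbf a,\mathbf a'\in\mathbb{Z}^N$, $T(\mathbf a)\cong T(\mathbf a')$ iff $\mathbf a-\mathbf a'\in\sigma(\mathbb{Z}^D)$. A divisorial ideal is conic if it is (isomorphic to) $T(\lceil\sigma(\mathbf x)\rceil)$ for some $\mathbf x\in\mathbb{R}^D$ (componentwise round-up). Stable set rings. Graphs are finite and simple. The stable set ring of $G$ is $\Bbbk[\mathrm{Stab}_G]=\Bbbk[(\prod_{i\in S}t_i)\,t_0 : S \text{ a stable set of } G]$ (the empty set and singletons are stable). For perfect $G$ with maximal cliques $Q_0,\dots,Q_n$, define linear forms on $\mathbb{R}^{d+1}$ (coordinates $x_0,\dots,x_d$) by $\sigma_i(\mathbf x)=x_0-\sum_{j\in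 Q_i}x_j$ for $0\le i\le n$ and $\sigma_i(\mathbf x)=x_{i-n}$ for $n+1\le i\le n+d$. With $\tau_G\subset\mathbb{R}^{d+1}$ the cone generated by $\sigma_0,\dots,\sigma_{n+d}$, one has $\Bbbk[\mathrm{Stab}_G]=\Bbbk[\tau_G^\vee\cap\mathbb{Z}^{d+1}]$; divisorial ideals $T(\mathbf a)$, $\mathbf a=(a_0,\dots,a_{n+d})$, are taken with respect to this presentation. Notation. For a finite multiset $L$ of elements of $\{0,\dots,n\}$ and $v\in V(G)$, $m_L(v)=|\{l\in L: v\in Q_l\}|$ (counted with multiplicity). For finite multisets $I,J$: $m_{IJ}(v)=m_I(v)-m_J(v)$, $X_{IJ}^+=\{v\in V(G):m_{IJ}(v)>0\}$, $X_{IJ}^-=\{v\in V(G):m_{IJ}(v)<0\}$. $I\cap J=\emptyset$ means that no element occurs in both. *)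

(* Defs.v *)
From HB Require Import structures.
From mathcomp Require Import all_boot all_order all_algebra finmap multiset.
From mathcomp Require Import boolp classical_sets functions reals.
From mathcomp Require Import mpoly.

Set Implicit Arguments.
Unset Strict Implicit.
Unset Printing Implicit Defensive.

Import Order.TTheory GRing.Theory Num.Theory.

Local Open Scope classical_set_scope.
Local Open Scope ring_scope.

Section Graphs.
Variables (V : finType) (e : rel V).
Implicit Types A S C : {set V}.

Definition clique C := [forall x in C, forall y in C, (x != y) ==> e x y].

Definition stable S := [forall x in S, forall y in S, ~~ e x y].

Definition clique_number A : nat :=
  \max_(C : {set V} | (C \subset A) && clique C) #|C|.

Definition proper_coloring A (f : {ffun V -> V}) :=
  [forall x in A, forall y in A, e x y ==> (f x != f y)].

(* The chromatic number of the subgraph induced on A. Naming the colours by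
   vertices and starting the minimum at #|A| loses nothing: for an irreflexive
   e, the identity is a proper colouring of A with #|A| colours. *)
Definition chromatic_number A : nat :=
  \big[minn/#|A|]_(f | proper_coloring A f) #|f @: A|.

Definition perfect := forall A, chromatic_number A = clique_number A.

End Graphs.

(* Subrings and submodules are subsets of the field of fractions
   k(t_0, ..., t_(D-1)), which contains the Laurent polynomial ring. *)
Notation ratfun k D := {fraction {mpoly k[D]}}.

Section Monomials.
Variables (k : closedFieldType) (D : nat).
Local Notation K := (ratfun k D).

Definition laurent_monomial (x : 'rV[int]_D) : K :=
  \prod_(i < D) tofrac ('X_i : {mpoly k[D]}) ^ (x 0 i).

Definition subalgebra (A : set K) :=
  [/\ forall c : k, A (tofrac c%:MP_[D]),
      forall f g, A f -> A g -> A (f + g) &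
      forall f g, A f -> A g -> A (f * g)].

Definition submodule (R M : set K) :=
  [/\ M 0,
      forall f g, M f -> M g -> M (f + g) &
      forall r f, R r -> M f -> M (r * f)].

Definition module_iso (R M N : set K) :=
  exists phi : K -> K,
    [/\ set_bij M N phi,
        forall f g, M f -> M g -> phi (f + g) = phi f + phi g &
        forall r f, R r -> M f -> phi (r * f) = r * phi f].

End Monomials.

Section Divisorial.
Variables (k : closedFieldType) (RR : realType) (D N : nat).
Local Notation K := (ratfun k D).
(* The rows of v are the primitive generators v_1, ..., v_N of the cone tau,
   and R is the toric ring k[tau^vee :&: Z^D], instantiated below by the
   stable set ring. *)
Variables (R : set K) (v : 'M[int]_(N, D)).

Definition sigma (A : pzRingType) (x : 'rV[A]_D) : 'rV[A]_N :=
  x *m (map_mx intr v)^T.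

Definition divisorial_module (a : 'rV[RR]_N) : set K :=
  smallest (submodule R)
    [set f | exists2 x : 'rV[int]_D,
       forall i, a 0 i <= sigma (map_mx intr x) 0 i & f = laurent_monomial k x].

Definition divisorial (M : set K) := exists a, M = divisorial_module a.

Definition conic (M : set K) :=
  divisorial M /\
  exists x : 'rV[RR]_D,
    module_iso R M
      (divisorial_module (map_mx (fun r => (Num.ceil r)%:~R) (sigma x))).

Definition iso_class (M : set K) : set (set K) :=
  [set M' | divisorial M' /\ module_iso R M M'].

Definition conic_classes : set (set (set K)) :=
  [set iso_class M | M in [set M | conic M]].

End Divisorial.

Section StableSetRing.
Variables (k : closedFieldType) (RR : realType) (d : nat).

(* Vertex j corresponds to the variable of index rshift 1 j; index 0 is t_0. *)
Definition stable_set_ring (e : rel 'I_d) : set (ratfun k (1 + d)) :=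
  smallest (@subalgebra k (1 + d))
    [set f | exists2 S : {set 'I_d}, stable e S &
       f = tofrac (\prod_(j in S) 'X_(rshift 1 j) * 'X_(lshift d 0)
                   : {mpoly k[1 + d]})].

Variable n : nat.
Variable Q : 'I_n.+1 -> {set 'I_d}.

(* The coefficient vectors of sigma_0, ..., sigma_(n+d); see sigma_stab. *)
Definition stab_gens : 'M[int]_(n.+1 + d, 1 + d) :=
  block_mx (const_mx 1) (\matrix_(i, j) - (j \in Q i)%:R)
           0            1%:M.

Lemma sigma_stab (A : pzRingType) (x : 'rV[A]_(1 + d)) :
  sigma stab_gens x =
  row_mx (\row_i (x 0 (lshift d 0) - \sum_(j in Q i) x 0 (rshift 1 j)))
         (\row_j x 0 (rshift 1 j)).
Proof.
rewrite /sigma /stab_gens map_block_mx tr_block_mx -[x in LHS]hsubmxK.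
rewrite mul_row_block; congr row_mx; apply/rowP=> i; rewrite !mxE.
- rewrite big_ord1 !mxE mulr1 -sumrN; congr (_ + _).
  rewrite [RHS]big_mkcond; apply: eq_bigr => j _; rewrite !mxE.
  by case: (j \in Q i); rewrite ?oppr0 ?mulr0 // rmorphN mulrN mulr1.
- rewrite big_ord1 !mxE mulr0 add0r (bigD1 i) //= !mxE eqxx mulr1.
  rewrite big1 ?addr0 // => j ji.
  by rewrite !mxE eq_sym (negPf ji) mulr0.
Qed.

Definition clique_mult (L : {mset 'I_n.+1}%mset) (v : 'I_d) : nat :=
  count (fun l => v \in Q l) L.

Definition mdiff (I J : {mset 'I_n.+1}%mset) (v : 'I_d) : int :=
  (clique_mult I v)%:Z - (clique_mult J v)%:Z.

Definition Xplus (I J : {mset 'I_n.+1}%mset) := [set v | 0 < mdiff I J v]%SET.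

Definition Xminus (I J : {mset 'I_n.+1}%mset) := [set v | mdiff I J v < 0]%SET.

(* (z_1, ..., z_n) |-> (z_0, z_1, ..., z_n) with z_0 = 0 *)
Definition extend0 (z : 'rV[RR]_n) : 'rV[RR]_n.+1 := row_mx (0 : 'rV_1) z.

Definition conic_region : set 'rV[RR]_n :=
  [set z | forall I J : {mset 'I_n.+1}%mset,
     size I = size J -> (0 < size I)%N -> (I `&` J = mset0)%mset ->
     - (size J)%:R + \sum_(v in Xminus I J) (mdiff I J v)%:~R + 1
       <= \sum_(i <- I) extend0 z 0 i - \sum_(j <- J) extend0 z 0 j
       <= (size I)%:R + \sum_(v in Xplus I J) (mdiff I J v)%:~R - 1].

End StableSetRing.

(* Main.v *)
(* Let [a = (0, z, 0)] with [z] integral.  The ideal [T(a)] is conic as soon as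
   the system [a_i - 1 < sigma_i(x) <= a_i] has a real solution.  By
   Fourier-Motzkin elimination (Motzkin's transposition theorem with integral
   multipliers) it has one unless some integral combination [y] of the rows
   vanishes while [sum_i (y_i a_i + max(0, - y_i)) <= 0].  Such a [y] is
   determined by its clique part; splitting this part into its positive and
   negative parts gives disjoint multisets [I] and [J] of equal size, and the
   condition on [y] is the negation of the lower inequality of [C(G)] for
   [(I, J)].  Conversely, translating by an integral point makes the vertex
   coordinates of a conic vector vanish, with [x_v] in [(-1, 0]], and the
   inequalities follow from [sigma_i(x) <= z_i < sigma_i(x) + 1] by summation.
   For injectivity, an isomorphism [T(a) -> T(b)] is the multiplication by a
   rational function [f] such that [f] and [1 / f] are Laurent polynomials, so
   [f] is a monomial [c t^y]; as every [sigma_i] attains the value [a_i] on the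
   exponents of [T(a)], this forces [b - a = sigma(y)]. *)
From mathcomp Require Import generic_quotient fraction mpoly finmap multiset.
From mathcomp Require Import zify ring lra.
Require Import Defs.
From mathcomp Require Import all_boot all_order all_algebra.
From mathcomp Require Import boolp classical_sets functions reals.

Import Order.TTheory GRing.Theory Num.Theory.

Local Open Scope classical_set_scope.
Local Open Scope ring_scope.

Set Implicit Arguments.
Unset Strict Implicit.
Unset Printing Implicit Defensive.

(** * Motzkin elimination for strict and weak linear inequalities *)

Section FourierMotzkin.
Variable F : realFieldType.

Definition holds (l : F) (b : F) (s : bool) := if s then l < b else l <= b.

Lemma holdsE l b s : holds l b s = (l < b) || ~~ s && (l == b).
Proof. by case: s => /=; rewrite /holds ?orbF // le_eqVlt orbC. Qed.

Lemma seq_argmin (T : eqType) (f : T -> F) (M : seq T) : M != [::] ->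
  exists2 m, m \in M & forall l, l \in M -> f m <= f l.
Proof.
elim: M => // m M IH _; case: (eqVneq M [::]) => [->|/IH[m' m'M le]].
  by exists m; rewrite ?mem_head // => l /[!inE]/eqP->.
case: (leP (f m') (f m)) => h.
  by exists m'; rewrite ?inE ?m'M ?orbT // => l /[!inE]/orP[/eqP->//|/le].
exists m; rewrite ?mem_head // => l.
by rewrite inE => /orP[/eqP->//|/le]; apply: le_trans; exact: ltW.
Qed.

(* The pairs are (bound, strictness). *)
Lemma interval_point (L U : seq (F * bool)) :
  (forall l u, l \in L -> u \in U -> holds l.1 u.1 (l.2 || u.2)) ->
  exists x, (forall l, l \in L -> holds l.1 x l.2) /\
            (forall u, u \in U -> holds x u.1 u.2).
Proof.
case: (eqVneq L [::]) => [->|/(seq_argmin (fun l => - l.1))[m mL Lm]];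
    case: (eqVneq U [::]) => [->|/(seq_argmin fst)[w wU wle]].
- by exists 0.
- exists (w.1 - 1); split=> // u /wle h; rewrite holdsE; apply/orP; left; lra.
- exists (m.1 + 1); split=> // u /Lm; rewrite lerN2 holdsE => h.
  by apply/orP; left; lra.
(* A bound can equal the midpoint only if the largest lower and the smallest upper bound coincide,
   and then [LU] makes that bound weak. *)
move=> LU; exists ((m.1 + w.1) / 2).
have mw : m.1 <= w.1.
  by have:= LU _ _ mL wU; rewrite holdsE => /orP[/ltW//|/andP[_ /eqP->]].
split=> [l lL|u uU]; rewrite holdsE.
- have:= Lm _ lL; rewrite lerN2; have := LU _ _ lL wU; rewrite holdsE negb_or.
  case: l.2 => /=; rewrite ?orbF => h1 h2; first by lra.
  by case: ltgtP => //=; lra.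
- have:= wle _ uU; have := LU _ _ mL uU; rewrite holdsE negb_or.
  case: u.2 => /=; rewrite ?andbF ?orbF => h1 h2; first by lra.
  by case: ltgtP => //=; lra.
Qed.

(* The triple [(a, b, s)] stands for [a . x < b] if [s], and for [a . x <= b] otherwise. *)
Definition constraint D : eqType := ('rV[int]_D * int * bool)%type.

Definition cadd D (c c' : constraint D) : constraint D :=
  (c.1.1 + c'.1.1, c.1.2 + c'.1.2, c.2 || c'.2).

Definition cmul D (m : nat) (c : constraint D) : constraint D :=
  (c.1.1 *+ m, c.1.2 *+ m, c.2).

Lemma cmul_closed D (P : constraint D -> Prop) m c :
  (forall c c', P c -> P c' -> P (cadd c c')) -> P c -> (0 < m)%N ->
  P (cmul m c).
Proof.
move=> Padd Pc; case: m => // m _; elim: m => [|m IH].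
  by rewrite /cmul !mulr1n -surjective_pairing -surjective_pairing.
rewrite /cmul !(mulrSr _ m.+1); have := Padd _ _ IH Pc.
by rewrite /cadd /= orbb.
Qed.

(* [P] plays the role of "derivable from [S]", so that no multipliers have to be
   named. The conclusion only evaluates the variables listed in [r], which makes
   the elimination of one variable an induction step on [r]. *)
Lemma fourier_motzkin D (r : seq 'I_D) (P : constraint D -> Prop)
    (S : seq (constraint D)) :
  uniq r -> (forall c c', P c -> P c' -> P (cadd c c')) ->
  (forall c, P c -> (forall i, i \in r -> c.1.1 0 i = 0) ->
     if c.2 then 0 < c.1.2 else 0 <= c.1.2) ->
  (forall c, c \in S -> P c) ->
  exists x : 'rV[F]_D, forall c, c \in S ->
    holds (\sum_(i <- r) (c.1.1 0 i)%:~R * x 0 i) c.1.2%:~R c.2.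
Proof.
elim: r P S => [|i r IH] P S /=.
  move=> _ _ H SP; exists 0 => c /SP/H => /(_ (fun _ _ => ltac:(done))).
  rewrite big_nil /holds; case: c.2; by rewrite ?ltr0z ?ler0z.
move=> /andP[ir ur] Padd P0 SP.
pose coef (c : constraint D) : int := c.1.1 0 i.
pose Sneg := [seq c <- S | coef c < 0]; pose Spos := [seq c <- S | 0 < coef c].
(* The crossed multipliers cancel coordinate [i]; both are positive when [coef c < 0 < coef c']. *)
pose elim c c' := cadd (cmul `|coef c'|%N c) (cmul `|coef c|%N c').
pose S' := [seq c <- S | coef c == 0] ++ [seq elim c c' | c <- Sneg, c' <- Spos].
(* The predicate passed on also demands a zero coefficient at [i], so a constraint that vanishes on
   [r] vanishes on [i :: r]. *)
have [||c|x xS'] := IH (fun c => P c /\ coef c = 0) S' ur.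
- move=> c c' [Pc c0] [Pc' c'0]; split; first exact: Padd.
  by rewrite /coef mxE -/(coef c) c0 add0r.
- move=> c [Pc c0] cr; apply: P0 => // j; rewrite inE => /orP[/eqP->//|].
  exact: cr.
- rewrite mem_cat mem_filter => /orP[/andP[/eqP c0 /SP]//|].
  case/allpairsP => -[c1 c2] /= [].
  rewrite !mem_filter => /andP[c1n /SP P1] /andP[c2p /SP P2] ->; split.
    by apply: (Padd); apply: (cmul_closed Padd) => //;
      rewrite absz_gt0 ?(gt_eqF c2p) ?(lt_eqF c1n).
  rewrite /coef /elim /= !(mxE, mulmxnE) -/(coef c1) -/(coef c2) !pmulrn !mulrzz.
  by rewrite (gtz0_abs c2p) (ltz0_abs c1n) mulrN mulrC subrr.
pose rest (c : constraint D) := \sum_(j <- r) (c.1.1 0 j)%:~R * x 0 j.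
(* With the other variables fixed at [x], this bounds variable [i] from above if [coef c > 0] and
   from below if [coef c < 0]. *)
pose bnd (c : constraint D) := (c.1.2%:~R - rest c) / (coef c)%:~R.
have [|t [tL tU]] := interval_point (L := [seq (bnd c, c.2) | c <- Sneg])
  (U := [seq (bnd c, c.2) | c <- Spos]).
  move=> _ _ /mapP[c cS ->] /mapP[c' c'S ->] /=.
  have /xS' : elim c c' \in S'.
    by rewrite mem_cat; apply/orP; right; apply/allpairsP; exists (c, c').
  move: cS c'S; rewrite !mem_filter => /andP[cn _] /andP[cp _].
  rewrite /elim /=.
  have -> : \sum_(j <- r) ((c.1.1 *+ `|coef c'| + c'.1.1 *+ `|coef c|) 0 j)%:~R
        * x 0 j = rest c * (coef c')%:~R - rest c' * (coef c)%:~R.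
    rewrite !mulr_suml -sumrB; apply: eq_bigr => j _.
    rewrite mxE !mulmxnE !pmulrn !mulrzz (gtz0_abs cp) (ltz0_abs cn).
    by rewrite rmorphD /= !rmorphM rmorphN /=; ring.
  rewrite !pmulrn !mulrzz (gtz0_abs cp) (ltz0_abs cn) /bnd.
  rewrite rmorphD /= !rmorphM rmorphN /=.
  move: cn cp; rewrite -(ltrz0 F) -(ltr0z F).
  move: (coef c)%:~R (coef c')%:~R => a a' a0 a'0.
  rewrite /holds ler_ndivrMr // ltr_ndivrMr // mulrAC.
  rewrite ler_pdivrMr // ltr_pdivrMr //.
  by case: (_ || _) => h; lra.
exists (\row_j if j == i then t else x 0 j) => c cS.
have -> : \sum_(j <- i :: r) (c.1.1 0 j)%:~R *
    (\row_j (if j == i then t else x 0 j)) 0 j = (coef c)%:~R * t + rest c.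
  rewrite big_cons mxE eqxx; congr (_ + _).
  rewrite big_seq [RHS]big_seq; apply: eq_bigr => j jr; rewrite mxE.
  by case: eqP jr ir => // -> ->.
have [c0|c0|c0] := ltgtP (coef c) 0; first 1 last.
- have /tU : (bnd c, c.2) \in [seq (bnd c, c.2) | c <- Spos].
    by apply: map_f; rewrite mem_filter c0.
  rewrite /= /holds /bnd ler_pdivlMr ?ltr_pdivlMr ?ltr0z //.
  by case: c.2; lra.
- have /xS' : c \in S' by rewrite mem_cat mem_filter c0 eqxx cS.
  by rewrite ?c0 mulr0z mul0r add0r.
- have /tL : (bnd c, c.2) \in [seq (bnd c, c.2) | c <- Sneg].
    by apply: map_f; rewrite mem_filter c0.
  rewrite /= /holds /bnd ler_ndivrMr ?ltr_ndivrMr ?ltrz0 //.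
  by case: c.2; lra.
Qed.
End FourierMotzkin.

(** * Integral vectors that are round-ups of real points *)

Section ConicCriterion.
Variables (RR : realType) (D N : nat) (v : 'M[int]_(N, D)) (a : 'rV[int]_N).

(* Bounds from below the right-hand side of every nonnegative combination of
   [sigma_i x <= a_i] and [- sigma_i x < 1 - a_i] whose left-hand side is
   [sum_i y_i sigma_i x]. *)
Definition ceil_cost (y : 'rV[int]_N) : int :=
  \sum_i (y 0 i * a 0 i + Num.max 0 (- y 0 i)).

Lemma ceil_cost0 : ceil_cost 0 = 0.
Proof. by rewrite /ceil_cost big1 // => i _; rewrite mxE mul0r oppr0 maxxx. Qed.

Lemma ceil_costD y y' : ceil_cost (y + y') <= ceil_cost y + ceil_cost y'.
Proof.
rewrite /ceil_cost -big_split; apply: ler_sum => i _ /=.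
rewrite !mxE mulrDl [leRHS]addrACA lerD2l.
case: (leP 0 (- y 0 i)); case: (leP 0 (- y' 0 i));
  case: (leP 0 (- (y 0 i + y' 0 i))); lia.
Qed.

(* The two multiplier vectors cancel, but each costs at least its negative part,
   so together they cost [sum_i |y_i|]. *)
Lemma ceil_costDN_gt0 y : y != 0 -> 0 < ceil_cost y + ceil_cost (- y).
Proof.
move=> y0; have [i yi] : exists i, y 0 i != 0.
  by apply/existsP; apply: contraNT y0 => /existsPn y0; apply/eqP/rowP => i;
    rewrite mxE; apply/eqP/negPn.
rewrite /ceil_cost -big_split (bigD1 i) //= ltr_wpDr //.
  apply: sumr_ge0 => j _; rewrite !mxE mulNr addrACA subrr add0r.
  by rewrite addr_ge0 // le_max lexx.
rewrite !mxE mulNr addrACA subrr add0r opprK.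
by case: (leP 0 (- y 0 i)); case: (leP 0 (y 0 i)); lia.
Qed.

Lemma ceil_cost_delta i :
  ceil_cost (delta_mx 0 i) = a 0 i /\ ceil_cost (- delta_mx 0 i) = 1 - a 0 i.
Proof.
rewrite /ceil_cost; split; rewrite (bigD1 i) //= big1 ?addr0; first 1 last.
- by move=> j ji; rewrite !mxE (negPf ji) mul0r.
- by rewrite !mxE !eqxx mulN1r addrC.
- by move=> j ji; rewrite !mxE (negPf ji) oppr0 mul0r.
- by rewrite !mxE !eqxx mul1r; lia.
Qed.

(** The system to solve is [sigma_i x <= a_i], [- sigma_i x < 1 - a_i]. A derived constraint with
    zero left-hand side comes from a [y] with [y *m v = 0], and its bound is at least [ceil_cost y],
    so it is never contradictory. *)
Lemma exists_ceil_sigma :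
  (forall y, y != 0 -> y *m v = 0 -> 0 < ceil_cost y) ->
  exists x : 'rV[RR]_D, forall i, Num.ceil (sigma v x 0 i) = a 0 i.
Proof.
move=> vP.
(* The last clause covers [y = 0], where [vP] says nothing: a strict constraint keeps a positive
   bound because cancelling nonzero multipliers has a positive cost. *)
pose P (c : constraint D) := exists y : 'rV_N,
  [/\ c.1.1 = y *m v, ceil_cost y <= c.1.2 & c.2 -> y = 0 -> 0 < c.1.2].
pose S : seq (constraint D) :=
  [seq (row i v, a 0 i, false) | i <- enum 'I_N] ++
  [seq (- row i v, 1 - a 0 i, true) | i <- enum 'I_N].
have [| |c cS|x xS] := @fourier_motzkin RR D (enum 'I_D) P S (enum_uniq _).
- move=> [[r1 b1] s1] [[r2 b2] s2] [y [/= -> yb ys]] [y' [/= -> yb' ys']].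
  exists (y + y'); split => /=; first by rewrite mulmxDl.
    exact: le_trans (ceil_costD _ _) (lerD yb yb').
  move=> ss /eqP; rewrite addrC addr_eq0 => /eqP yy.
  have [y0|/ceil_costDN_gt0] := eqVneq y 0; last by rewrite -yy; lia.
  move: yy yb yb'; rewrite y0 oppr0 => y'0; rewrite y'0 ceil_cost0.
  by case/orP: ss => [/ys/(_ y0)|/ys'/(_ y'0)]; lia.
- move=> [[r b] s] [y [/= -> yb ys]] yv.
  have {}yv : y *m v = 0.
    by apply/rowP => i; rewrite yv ?mxE // mem_enum.
  have [y0|/vP/(_ yv)] := eqVneq y 0; last by case: s {ys}; lia.
  by move: yb ys; rewrite y0 ceil_cost0; case: s => // _ /(_ isT erefl).
- move: cS; rewrite mem_cat => /orP[] /mapP[i _ ->];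
    have [ci cNi] := ceil_cost_delta i.
    by exists (delta_mx 0 i); split; rewrite //= -?rowE ?ci.
  exists (- delta_mx 0 i); split; rewrite /= ?mulNmx -?rowE ?cNi //.
  by move=> _ /eqP; rewrite oppr_eq0 => /eqP/rowP/(_ i); rewrite !mxE !eqxx.
exists x => i; apply: ceil_def.
have sE (w : 'rV[int]_D) : \sum_(j <- enum 'I_D) (w 0 j)%:~R * x 0 j =
    (x *m (map_mx intr w)^T) 0 0.
  by rewrite mxE big_enum; apply: eq_bigr => j _; rewrite !mxE mulrC.
have siE : sigma v x 0 i = (x *m (map_mx intr (row i v))^T) 0 0.
  by rewrite /sigma !mxE; apply: eq_bigr => j _; rewrite !mxE.
have /xS /= : (row i v, a 0 i, false) \in S.
  by rewrite mem_cat map_f ?mem_enum.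
have /xS /= : (- row i v, 1 - a 0 i, true) \in S.
  by rewrite mem_cat; apply/orP; right; apply/mapP; exists i; rewrite ?mem_enum.
rewrite !sE siE /holds map_mxN linearN mulmxN mxE rmorphB /= => h1 ->.
by rewrite andbT rmorphB /=; lra.
Qed.
End ConicCriterion.

(** * Multisets of cliques and the inequalities of [conic_region] *)

Lemma big_seq_count (T : finType) (A : nmodType) (s : seq T) (f : T -> A) :
  \sum_(i <- s) f i = \sum_i f i *+ count_mem i s.
Proof.
elim: s => [|x s IH]; first by rewrite big_nil big1.
rewrite big_cons IH /= [RHS](eq_bigr (fun i => f i *+ (x == i) + f i *+ count_mem i s)).
  rewrite big_split /=; congr (_ + _); rewrite (bigD1 x) //= eqxx mulr1n.
  by rewrite big1 ?addr0 // => i /negPf; rewrite eq_sym => ->.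
by move=> i _; rewrite mulrnDr.
Qed.

Lemma exists_mset (T : finType) (f : T -> nat) : exists M : {mset T}%mset, M =1 f.
Proof.
exists ([fsfun i in [fset x | x in enum T]%fset => f i] : {mset T}%mset) => i.
by rewrite fsfunE inE /= mem_enum.
Qed.

Section Region.
Variables (RR : realType) (d n : nat) (Q : 'I_n.+1 -> {set 'I_d}).
Implicit Types I J : {mset 'I_n.+1}%mset.

Lemma mdiff_swap I J v : mdiff Q I J v = - mdiff Q J I v.
Proof. by rewrite /mdiff opprB. Qed.

Lemma Xminus_swap I J : Xminus Q I J = Xplus Q J I.
Proof. by apply/setP => v; rewrite !inE mdiff_swap oppr_lt0. Qed.

Lemma sum_Xminus I J :
  \sum_(v in Xminus Q I J) mdiff Q I J v = - \sum_(v in Xplus Q J I) mdiff Q J I v.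
Proof.
by rewrite Xminus_swap -sumrN; apply: eq_bigr => v _; rewrite mdiff_swap.
Qed.

Lemma sum_cliques I (A : pzRingType) (u : 'I_d -> A) :
  \sum_(i <- I) \sum_(j in Q i) u j = \sum_j u j *+ clique_mult Q I j.
Proof.
rewrite /clique_mult; under eq_bigr do rewrite big_mkcond.
rewrite exchange_big; apply: eq_bigr => j _ /=.
by rewrite -big_mkcond big_const_seq iter_addr addr0.
Qed.

Lemma clique_multE I v : (clique_mult Q I v)%:Z = \sum_i (I i)%:Z *+ (v \in Q i).
Proof.
rewrite /clique_mult -sum1_count big_mkcond -[LHS]natz natr_sum big_seq_count.
apply: eq_bigr => i _; rewrite count_mem_mset.
by case: (v \in Q i); rewrite ?mul0rn /= ?natz.
Qed.

Lemma mdiffE I J v :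
  mdiff Q I J v = \sum_i ((I i)%:Z - (J i)%:Z) *+ (v \in Q i).
Proof.
by rewrite /mdiff !clique_multE -sumrB; apply: eq_bigr => i _; rewrite mulrnBl.
Qed.

(** Integral counterpart of [conic_region], in which [c 0] need not be 0. *)
Definition int_region (c : 'I_n.+1 -> int) := forall I J : {mset 'I_n.+1}%mset,
  size I = size J -> (0 < size I)%N -> (I `&` J = mset0)%mset ->
  - (size J)%:Z + \sum_(v in Xminus Q I J) mdiff Q I J v + 1
    <= \sum_(i <- I) c i - \sum_(j <- J) c j
    <= (size I)%:Z + \sum_(v in Xplus Q I J) mdiff Q I J v - 1.

Lemma conic_region_int (z : 'rV[RR]_n) (c : 'I_n.+1 -> int) :
  (forall i, extend0 z 0 i = (c i)%:~R) -> conic_region Q z <-> int_region c.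
Proof.
move=> zc.
have eqv I J :
   (- (size J)%:R + \sum_(v in Xminus Q I J) (mdiff Q I J v)%:~R + 1
     <= \sum_(i <- I) extend0 z 0 i - \sum_(j <- J) extend0 z 0 j
     <= (size I)%:R + \sum_(v in Xplus Q I J) (mdiff Q I J v)%:~R - 1) =
   (- (size J)%:Z + \sum_(v in Xminus Q I J) mdiff Q I J v + 1
     <= \sum_(i <- I) c i - \sum_(j <- J) c j
     <= (size I)%:Z + \sum_(v in Xplus Q I J) mdiff Q I J v - 1).
  have zs (s : seq 'I_n.+1) :
      \sum_(i <- s) extend0 z 0 i = (\sum_(i <- s) c i)%:~R.
    by rewrite rmorph_sum; apply: eq_bigr => i _; exact: zc.
  by rewrite !zs -!rmorph_sum -rmorphB /= -!(ler_int RR) !rmorphD !rmorphN /=.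
by split=> H I J IJ I0 disj; have := H I J IJ I0 disj; rewrite eqv.
Qed.

(** When [s i <= ceil (s i) < s i + 1] is summed over [I] and [J], the coordinate [x_0] cancels
    because the sizes agree. There remain the terms [- x_v * mdiff v] with [x_v] in [(-1, 0]], each
    at most [max(0, mdiff v)]. Strictness comes from a member of the nonempty [I]. *)
Lemma ceil_int_region (x : 'rV[RR]_(1 + d)) :
  (forall j, Num.ceil (x 0 (rshift 1 j)) = 0) ->
  int_region (fun i =>
    Num.ceil (x 0 (lshift d 0) - \sum_(j in Q i) x 0 (rshift 1 j))).
Proof.
move=> x0.
set s := fun i => x 0 (lshift d 0) - \sum_(j in Q i) x 0 (rshift 1 j).
change (int_region (fun i => Num.ceil (s i))).
have up I J : size I = size J -> (0 < size I)%N ->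
    \sum_(i <- I) Num.ceil (s i) - \sum_(j <- J) Num.ceil (s j) <
    (size I)%:Z + \sum_(v in Xplus Q I J) mdiff Q I J v.
  move=> IJ I0; rewrite -(ltr_int RR) rmorphB rmorphD /= !rmorph_sum /=.
  have lt_I : \sum_(i <- I) (Num.ceil (s i))%:~R < \sum_(i <- I) (s i + 1).
    have [l lI] : exists l, l \in (I : seq _).
      by case: (I : seq _) I0 => // l ? _; exists l; rewrite mem_head.
    rewrite !(big_rem l lI) /= ltr_leD //.
      by have := ceilB1_lt (s l); rewrite rmorphB /=; lra.
    apply: ler_sum => i _; have := ceilB1_lt (s i); rewrite rmorphB /=; lra.
  have le_J : \sum_(i <- J) s i <= \sum_(i <- J) (Num.ceil (s i))%:~R.
    by apply: ler_sum => i _; exact: ceil_ge.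
  have sI (K : {mset 'I_n.+1}%mset) : \sum_(i <- K) s i =
      (x 0 (lshift d 0)) *+ size K - \sum_j x 0 (rshift 1 j) *+ clique_mult Q K j.
    rewrite /s sumrB sum_cliques; congr (_ - _).
    by rewrite big_const_seq iter_addr addr0 count_predT.
  have le_m : - \sum_j x 0 (rshift 1 j) *+ clique_mult Q I j
      + \sum_j x 0 (rshift 1 j) *+ clique_mult Q J j <=
      \sum_(v in Xplus Q I J) (mdiff Q I J v)%:~R.
    rewrite addrC -sumrB [leRHS]big_mkcond; apply: ler_sum => v _.
    rewrite inE /mdiff -mulr_natr -[_ *+ _ in X in _ - X]mulr_natr -mulrBr.
    rewrite -[_%:R - _]opprB -[_%:R - _](rmorphB (intmul (1 : RR)) _%:Z _%:Z).
    rewrite -/(mdiff Q I J v).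
    have /eqP := x0 v; rewrite ceil_eq => /andP[]; rewrite sub0r => h1 h2.
    have [m0|m0] := ltP 0 (mdiff Q I J v); move: m0.
      by rewrite -(ltr0z RR) => m0; nra.
    by rewrite -(lerz0 RR) => m0; nra.
  move: lt_I le_J le_m; rewrite big_split /= !sI IJ.
  rewrite big_const_seq iter_addr addr0 count_predT IJ -pmulrn.
  lra.
(* The lower inequality is the upper one for [(J, I)]; strictness between integers yields the [+ 1]
   and [- 1]. *)
clearbody s => {x0} I J IJ I0 disj /=; have := up I J IJ I0.
have := up J I (esym IJ); rewrite -IJ => /(_ I0).
rewrite sum_Xminus -!lezD1 => h1 h2; apply/andP; split; lra.
Qed.

(** The [t_0] column makes the clique part [p] of [y] sum to zero, and the vertex columns express
    the vertex part [q] through [p]. With [I] and [J] the positive and negative parts of [p], [q] is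
    [mdiff], and the lower inequality for [(I, J)] says that the cost is at least 1. *)
Lemma int_region_cost_gt0 (c : 'I_n.+1 -> int) (y : 'rV[int]_(n.+1 + d)) :
  int_region c -> y != 0 -> y *m stab_gens Q = 0 ->
  0 < ceil_cost (row_mx (\row_i c i) 0) y.
Proof.
rewrite -[y]hsubmxK; move: (lsubmx y) (rsubmx y) => p q {y} cR y0.
rewrite /stab_gens mul_row_block mulmx0 addr0 mulmx1 -row_mx0.
move=> /eq_row_mx[/rowP/(_ 0) /[!mxE] psum /rowP pq].
have {}psum : \sum_i p 0 i = 0.
  by rewrite -[RHS]psum; apply: eq_bigr => i _; rewrite mxE mulr1.
have {}pq j : q 0 j = \sum_i p 0 i *+ (j \in Q i).
  have := pq j; rewrite !mxE => /eqP; rewrite addrC addr_eq0 => /eqP ->.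
  rewrite -sumrN; apply: eq_bigr => i _; rewrite !mxE mulrN opprK.
  by rewrite mulr_natr.
have [I IE] := exists_mset (fun i => absz (Num.max 0 (p 0 i))).
have [J JE] := exists_mset (fun i => absz (Num.max 0 (- p 0 i))).
have IJp i : (I i)%:Z - (J i)%:Z = p 0 i.
  by rewrite IE JE; case: (leP 0 (p 0 i)); case: (leP 0 (- p 0 i)); lia.
have Jp i : (J i)%:Z = Num.max 0 (- p 0 i).
  by rewrite JE; case: (leP 0 (- p 0 i)); lia.
have sumIJ (f : 'I_n.+1 -> int) :
    \sum_(i <- I) f i - \sum_(i <- J) f i = \sum_i p 0 i * f i.
  rewrite (big_seq_count I) (big_seq_count J) -sumrB; apply: eq_bigr => i _.
  rewrite !count_mem_mset -IJp mulrBl.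
  by rewrite -mulr_natl natz; congr (_ - _); rewrite -mulr_natl natz.
have sizeE (K : {mset 'I_n.+1}%mset) : (size K)%:Z = \sum_i (K i)%:Z.
  rewrite -sum1_size -[LHS]natz natr_sum big_seq_count; apply: eq_bigr => i _.
  by rewrite count_mem_mset; exact: natz.
have IJ : size I = size J.
  apply/eqP; rewrite -eqz_nat -subr_eq0 !sizeE -sumrB.
  by rewrite (eq_bigr (fun i => p 0 i)) ?psum.
have mE v : mdiff Q I J v = q 0 v.
  by rewrite mdiffE pq; apply: eq_bigr => i _; rewrite IJp.
(* Otherwise [p] vanishes, and with it [q], against [y != 0]. *)
have I0 : (0 < size I)%N.
  rewrite lt0n; apply: contraNneq y0 => I0.
  have p0 : p = 0.
    apply/rowP => i; rewrite mxE -IJp -!count_mem_mset.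
    move: (I0); rewrite IJ => /eqP/nilP ->.
    by move/eqP/nilP: I0 => ->.
  have -> : q = 0.
    by apply/rowP => j; rewrite pq p0 big1 ?mxE // => i _; rewrite mxE mul0rn.
  by rewrite p0 row_mx0.
have disj : (I `&` J = mset0)%mset.
  apply/msetP => i; rewrite msetE2 mset0E IE JE.
  by case: (leP 0 (p 0 i)); case: (leP 0 (- p 0 i)); lia.
have /andP[low _] := cR I J IJ I0 disj.
rewrite /ceil_cost big_split_ord /=.
under eq_bigr do rewrite !row_mxEl mxE -Jp.
under [X in _ + X]eq_bigr do rewrite !row_mxEr [X in _ * X]mxE mulr0 add0r.
rewrite big_split /= -sumIJ -sizeE.
have -> : \sum_j Num.max 0 (- q 0 j) = - \sum_(v in Xminus Q I J) mdiff Q I J v.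
  rewrite -sumrN [RHS]big_mkcond; apply: eq_bigr => j _; rewrite inE mE.
  by case: ltP => h; case: (leP 0 (- q 0 j)); lia.
move: low; rewrite -lezD1; lra.
Qed.

End Region.

(** * Isomorphisms between submodules of the fraction field *)

Section ModuleIso.
Variables (k : closedFieldType) (D : nat) (R : set (ratfun k D)).
Local Notation K := (ratfun k D).
Implicit Types M N P : set K.

Lemma smallest_submodule (G : set K) : submodule R (smallest (submodule R) G).
Proof.
split=> [|f g fG gG|r f Rr fG] A [A_sub GA]; have [A0 AD AM] := A_sub.
- exact: A0.
- by apply: AD; [apply: fG|apply: gG].
- by apply: AM => //; apply: fG.
Qed.

Lemma module_iso_refl M : module_iso R M M.
Proof.
exists id; split=> //; split=> // x Mx; by exists x.
Qed.

Lemma module_iso_trans M N P :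
  module_iso R M N -> module_iso R N P -> module_iso R M P.
Proof.
move=> [f [bf fD fM]] [g [bg gD gM]]; have [fN _ _] := bf.
exists (g \o f); split=> [|x y Mx My|r x Rr Mx] /=; first exact: set_bij_comp bf bg.
  by rewrite fD ?gD //; apply: fN.
by rewrite fM ?gM //; apply: fN.
Qed.

Lemma module_iso_sym M N : submodule R M -> module_iso R M N -> module_iso R N M.
Proof.
move=> [_ MD MM] [f [bf fD fM]]; have [fN f_inj f_surj] := bf.
have [g gP] : exists g, forall y, N y -> M (g y) /\ f (g y) = y.
  have [g gP] : {g & forall y, N y -> M (g y) /\ f (g y) = y}.
    apply: (choice (P := fun y x => N y -> M x /\ f x = y)) => y.
    (* Outside [N] the inverse gets the harmless value 0. *)
    have [Ny|nNy] := pselect (N y); last by exists 0.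
    by have [x Mx fx] := f_surj y Ny; exists x.
  by exists g.
have gM y : N y -> M (g y) by move=> /gP[].
have fg y : N y -> f (g y) = y by move=> /gP[].
have gf x : M x -> g (f x) = x.
  move=> Mx; apply: f_inj; rewrite ?inE //; last by apply: fg; apply: fN.
  by apply: gM; apply: fN.
exists g; split.
- split=> [y /gM//|y y' /[!inE] Ny Ny' gyy|x Mx].
    by rewrite -(fg y) // gyy fg.
  by exists (f x); [exact: fN|exact: gf].
- move=> y y' Ny Ny'; rewrite -[in LHS](fg y) // -[in LHS](fg y') //.
  by rewrite -fD ?gf //; [apply: MD| |]; apply: gM.
- move=> r y Rr Ny; rewrite -[in LHS](fg y) // -fM ?gf //; last exact: gM.
  by apply: MM => //; exact: gM.
Qed.


End ModuleIso.

(** * Laurent polynomials and their exponents *)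

Section Laurent.
Variables (k : closedFieldType) (D : nat).
Local Notation K := (ratfun k D).
Local Notation lm := (@laurent_monomial k D).

Lemma tofracX_neq0 (m : 'X_{1..D}) : tofrac ('X_[m] : {mpoly k[D]}) != 0 :> K.
Proof. by rewrite tofrac_eq0 -msupp_eq0 msuppX. Qed.

Lemma laurent_monomialD x y : lm (x + y) = lm x * lm y.
Proof.
rewrite /laurent_monomial -big_split; apply: eq_bigr => i _ /=.
by rewrite mxE expfzDr // tofracX_neq0.
Qed.

Lemma laurent_monomial0 : lm 0 = 1.
Proof. by rewrite /laurent_monomial big1 // => i _; rewrite mxE expr0z. Qed.

Lemma laurent_monomial_neq0 x : lm x != 0.
Proof.
by apply/prodf_neq0 => i _; rewrite expfz_neq0 // tofracX_neq0.
Qed.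

Lemma laurent_monomialN x : lm (- x) = (lm x)^-1.
Proof.
apply: (mulfI (laurent_monomial_neq0 x)); rewrite -laurent_monomialD subrr.
by rewrite laurent_monomial0 divff // laurent_monomial_neq0.
Qed.

Definition exponent (m : 'X_{1..D}) : 'rV[int]_D := \row_i (m i)%:Z.

Lemma tofracX (m : 'X_{1..D}) : tofrac ('X_[m] : {mpoly k[D]}) = lm (exponent m).
Proof.
rewrite mpolyXE_id rmorph_prod; apply: eq_bigr => i _.
by rewrite rmorphXn mxE.
Qed.

Lemma exponentD m1 m2 : exponent (m1 + m2) = exponent m1 + exponent m2.
Proof. by apply/rowP => i; rewrite !mxE mnmDE PoszD. Qed.

Lemma exponent_diff (x : 'rV[int]_D) : exists m1 m2, x = exponent m1 - exponent m2.
Proof.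
exists [multinom absz (Num.max 0%R (x 0%R i)) | i < D].
exists [multinom absz (Num.max 0%R (- x 0%R i)%R) | i < D].
apply/rowP => i; rewrite !mxE !mnmE.
by case: (leP 0 (x 0 i)); case: (leP 0 (- x 0 i)); lia.
Qed.

(* The Laurent polynomials whose monomials have their exponents in [A]. *)
Definition laurent_span (A : set 'rV[int]_D) : set K :=
  [set f | exists x (p : {mpoly k[D]}), f = lm x * tofrac p /\
     forall m, m \in msupp p -> A (x + exponent m)].

Lemma laurent_spanM A B C f g : (forall x y, A x -> B y -> C (x + y)) ->
  laurent_span A f -> laurent_span B g -> laurent_span C (f * g).
Proof.
move=> ABC [x [p [-> pA]]] [y [q [-> qB]]]; exists (x + y), (p * q); split.
  by rewrite laurent_monomialD tofracM mulrACA.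
move=> m /msuppM_le/allpairsP[[m1 m2] /= [m1p m2q ->]].
by rewrite exponentD addrACA; apply: ABC; [apply: pA|apply: qB].
Qed.

Lemma laurent_spanD A f g :
  laurent_span A f -> laurent_span A g -> laurent_span A (f + g).
Proof.
move=> [x [p [-> pA]]] [y [q [-> qA]]].
(* Both summands are rewritten over the common base exponent [x - exponent m1 = y - exponent m2]. *)
have [m1 [m2 xy]] := exponent_diff (x - y).
have xyE : x - exponent m1 = y - exponent m2.
  by apply/rowP => i; have := congr1 (fun w : 'rV_D => w 0 i) xy; rewrite !mxE; lra.
exists (x - exponent m1), ('X_[m1] * p + 'X_[m2] * q); split.
  rewrite tofracD !tofracM !tofracX mulrDr {2}xyE !mulrA -!laurent_monomialD.
  by rewrite !subrK.
move=> m /msuppD_le; rewrite mem_cat => /orP[] /msuppM_le/allpairsP;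
    rewrite msuppX => -[[u v] /= []]; rewrite inE => /eqP-> vp ->.
  by rewrite exponentD addrA subrK; apply: pA.
by rewrite xyE exponentD addrA subrK; apply: qA.
Qed.

Lemma laurent_span_monomial A c x : A x -> laurent_span A (tofrac c%:MP * lm x).
Proof.
move=> Ax; exists x, c%:MP; split; first by rewrite mulrC.
move=> m; rewrite msuppC; case: ifP => // _ /[!inE] /eqP->.
by rewrite (_ : exponent 0%MM = 0) ?addr0 //; apply/rowP => i; rewrite !mxE mnmE.
Qed.

(** Exponents do not depend on the chosen representation: clearing denominators gives
    [c X^m1 = X^m2 p], and as [c != 0], [m1] is [m2] plus an exponent of [p]. *)
Lemma laurent_monomial_span A c x : c != 0 ->
  laurent_span A (tofrac c%:MP * lm x) -> A x.
Proof.
move=> c0 [y [p [cE pA]]]; have [m1 [m2 xy]] := exponent_diff (x - y).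
have /eqP : tofrac (c%:MP * 'X_[m1]) = tofrac ('X_[m2] * p).
  rewrite !tofracM !tofracX.
  apply: (mulfI (laurent_monomial_neq0 (y - exponent m2))).
  rewrite [RHS]mulrA -laurent_monomialD subrK -cE mulrCA; congr (_ * _).
  rewrite -laurent_monomialD; congr lm.
  by rewrite -addrA [- _ + _]addrC -xy addrC subrK.
rewrite tofrac_eq mul_mpolyC => /eqP E.
have : m1 \in msupp ('X_[m2] * p) by rewrite -E msuppMCX // mem_head.
move=> /msuppM_le/allpairsP; rewrite msuppX => -[[u v] /= []].
rewrite inE => /eqP-> vp m1E.
suff -> : x = y + exponent v by apply: pA.
move: xy; rewrite m1E exponentD /= [_ + exponent v]addrC addrK => <-.
by rewrite addrC subrK.
Qed.

End Laurent.

(** * Factors of monomials and units of the Laurent ring *)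

Section MonomialDivisors.
Variables (k : idomainType) (D : nat).
Implicit Types p q : {mpoly k[D]}.

(** The monomial order is compatible with addition, so no other pair of support monomials has the
    same sum as the two lowest ones. *)
Lemma mcoeffM_mlast p q :
  (p * q)@_(mlast p + mlast q) = p@_(mlast p) * q@_(mlast q).
Proof.
have [->|p0] := eqVneq p 0; first by rewrite !mcoeff0 !mul0r mcoeff0.
have [->|q0] := eqVneq q 0; first by rewrite !mcoeff0 !mulr0 mcoeff0.
rewrite mpolyME (bigD1_seq (mlast p, mlast q)) /=; first last.
+ by rewrite allpairs_uniq // => -[? ?] [].
+ by rewrite allpairs_f // !mlast_supp.
rewrite mcoeffD mcoeffZ mcoeffX eqxx mulr1.
rewrite big_seq_cond raddf_sum /= big1 ?addr0 //.
move=> _ /andP[/allpairsP[[m1 m2] /= [m1p m2q ->]]]; rewrite xpair_eqE /= => ne.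
rewrite mcoeffZ mcoeffX; case: eqP => [E|]; rewrite ?mulr0 //.
case/negP: ne; move/mlast_lemc: m1p; move/mlast_lemc: m2q.
rewrite !le_eqVlt => /predU1P[E2|lt2] /predU1P[E1|lt1]; rewrite ?E1 ?E2 ?eqxx //.
- by have := ltmc_add2l (mlast p) m1 m2; rewrite E E2 ltxx lt1.
- by have := ltmc_add2r m1 (mlast q) m2; rewrite E E1 ltxx lt2.
- by have := ltmc_le_add lt1 (ltW lt2); rewrite E ltxx.
Qed.

Lemma mulmp_eqX p q m : p * q = 'X_[m] -> exists c u, p = c *: 'X_[u].
Proof.
move=> pq; have : p * q != 0 by rewrite pq -msupp_eq0 msuppX.
rewrite mulf_eq0 negb_or => /andP[p0 q0].
(* Leading and lowest monomials are both multiplicative. *)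
have leadE : m = (mlead p + mlead q)%MM.
  by rewrite -(mleadXm k m) -pq mleadM.
have lastE : m = (mlast p + mlast q)%MM.
  have : (p * q)@_(mlast p + mlast q) != 0.
    by rewrite mcoeffM_mlast mulf_neq0 // -mcoeff_msupp mlast_supp.
  by rewrite pq mcoeffX; case: (m =P _) => //= _; rewrite eqxx.
have last_lead (r : {mpoly k[D]}) : r != 0 -> (mlast r <= mlead r)%O.
  by move=> /mlast_supp/msupp_le_mlead.
(* Both sums equal [m] and each lowest monomial is at most the leading one, so neither inequality
   can be strict. *)
have eq_lead : mlast p = mlead p.
  apply/eqP; have := last_lead _ p0; rewrite le_eqVlt => /orP[//|lt].
  by have := ltmc_le_add lt (last_lead _ q0); rewrite -leadE -lastE ltxx.
exists p@_(mlead p), (mlead p); apply/mpolyP => u; rewrite mcoeffZ mcoeffX.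
have [<-|ne] := eqVneq (mlead p) u; first by rewrite mulr1.
rewrite mulr0; apply: memN_msupp_eq0; apply: contra ne => up.
by rewrite eq_le -{1}eq_lead mlast_lemc // msupp_le_mlead.
Qed.
End MonomialDivisors.

Section LaurentUnits.
Variables (k : closedFieldType) (D : nat).
Local Notation K := (ratfun k D).
Local Notation lm := (@laurent_monomial k D).

(** Clearing denominators turns [f * g = 1] into a factorisation of a monomial into polynomials, to
    which [mulmp_eqX] applies. *)
Lemma laurent_unit (f g : K) :
  laurent_span setT f -> laurent_span setT g -> f * g = 1 ->
  exists2 c : k, c != 0 & exists y, f = tofrac c%:MP * lm y.
Proof.
move=> [x [p [-> _]]] [y [q [-> _]]] fg.
have [m1 [m2 xy]] := exponent_diff (- (x + y)).
have PQ : tofrac p * tofrac q = lm (exponent m1 - exponent m2) :> K.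
  rewrite -xy laurent_monomialN; apply: (mulfI (laurent_monomial_neq0 k (x + y))).
  by rewrite divff ?laurent_monomial_neq0 // laurent_monomialD mulrACA.
have pq : ('X_[m2] * p) * q = 'X_[m1] :> {mpoly k[D]}.
  apply/eqP; rewrite -tofrac_eq !tofracM !tofracX -mulrA PQ.
  by rewrite -laurent_monomialD addrC subrK.
have [c [u E]] := mulmp_eqX pq.
have c0 : c != 0.
  apply: contraPneq pq => c0; rewrite E c0 scale0r mul0r => /eqP.
  by rewrite eq_sym -msupp_eq0 msuppX.
exists c => //; exists (x + exponent u - exponent m2).
apply: (mulfI (laurent_monomial_neq0 k (exponent m2))).
rewrite mulrCA -[in LHS]tofracX -tofracM E -mul_mpolyC tofracM tofracX.
rewrite [LHS]mulrCA [RHS]mulrCA -!laurent_monomialD; congr (_ * lm _).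
by rewrite [RHS]addrC subrK.
Qed.

End LaurentUnits.

(** * Divisorial ideals: translations and isomorphisms *)

Section Divisorial.
Variables (k : closedFieldType) (RR : realType) (D N : nat).
Variables (R : set (ratfun k D)) (v : 'M[int]_(N, D)).
Local Notation K := (ratfun k D).
Local Notation lm := (@laurent_monomial k D).
Local Notation T := (@divisorial_module k RR D N R v).
Implicit Types a b : 'rV[RR]_N.

(** The exponents of the generators of [T a]; for [a = 0], the lattice points of the dual cone. *)
Definition shifted_cone a : set 'rV[int]_D :=
  [set x | forall i, a 0 i <= sigma v (map_mx intr x) 0 i].

Lemma sigmaD (A : pzRingType) (x y : 'rV[A]_D) :
  sigma v (x + y) = sigma v x + sigma v y.
Proof. exact: mulmxDl. Qed.

Lemma sigmaN (A : pzRingType) (x : 'rV[A]_D) : sigma v (- x) = - sigma v x.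
Proof. exact: mulNmx. Qed.

Lemma divisorial_submodule a : submodule R (T a).
Proof. exact: smallest_submodule. Qed.

Lemma monomial_divisorial a x : shifted_cone a x -> T a (lm x).
Proof. by move=> ax; apply: sub_gen_smallest; exists x. Qed.

(** Multiplication by [t^y] shifts exponents by [y], and [t^(-y)] undoes it; [sub], general in [b]
    and [w], serves both directions. *)
Lemma divisorial_translate a (y : 'rV[int]_D) :
  module_iso R (T a) (T (a + sigma v (map_mx intr y))).
Proof.
have sub b (w : 'rV[int]_D) f :
    T b f -> T (b + sigma v (map_mx intr w)) (lm w * f).
  apply: (smallest_sub (X := [set f | T (b + _) (lm w * f)])).
    have [M0 MD MM] := divisorial_submodule (b + sigma v (map_mx intr w)).
    split=> [|g h /= Mg Mh|r g Rr /= Mg] /=; first by rewrite mulr0.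
      by rewrite mulrDr; apply: MD.
    by rewrite mulrCA; apply: MM.
  move=> _ [x bx ->] /=; rewrite -laurent_monomialD.
  apply: monomial_divisorial => i; rewrite map_mxD sigmaD addrC !mxE.
  by rewrite lerD2l; have := bx i; rewrite !mxE.
exists ( *%R (lm y)); split; last 2 first.
- by move=> f g _ _; rewrite mulrDr.
- by move=> r f _ _; rewrite mulrCA.
split=> [f /sub//|f g _ _|f Mf]; first exact/mulfI/laurent_monomial_neq0.
exists (lm (- y) * f).
  by have := sub _ (- y) _ Mf; rewrite map_mxN sigmaN addrK.
by rewrite mulrA -laurent_monomialD subrr laurent_monomial0 mul1r.
Qed.

Hypothesis R_span : R `<=` laurent_span (shifted_cone 0).

Lemma divisorial_span a : T a `<=` laurent_span (shifted_cone a).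
Proof.
apply: smallest_sub.
  split=> [|f g|r f Rr].
  - by exists 0, 0; split; [rewrite tofrac0 mulr0|rewrite msupp0].
  - exact: laurent_spanD.
  - apply: laurent_spanM (R_span Rr) => x y x0 ya i.
    rewrite map_mxD sigmaD mxE -[a 0 i]add0r lerD //.
    by have := x0 i; rewrite mxE.
move=> _ [x ax ->]; rewrite -[lm x]mul1r -tofrac1 -mpolyC1.
exact: laurent_span_monomial.
Qed.

Hypothesis R_frac : forall f : K, exists r s, [/\ R r, R s, s != 0 & s * f = r].

(** Any [m] satisfies [s m = r m0] with [r], [s] in [R] and [s != 0], so linearity forces
    [phi m = (phi m0 / m0) m]. *)
Lemma module_iso_mul (M M' : set K) m0 : submodule R M ->
  M m0 -> m0 != 0 -> module_iso R M M' ->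
  exists2 f, f != 0 & forall m, M m <-> M' (f * m).
Proof.
move=> [M0 _ _] Mm0 m0_neq0 [phi [[phiM' phi_inj phi_surj] _ phiM]].
have phiE m : M m -> phi m = phi m0 / m0 * m.
  move=> Mm; have [r [s [Rr Rs s0 sE]]] := R_frac (m / m0).
  have sm : s * m = r * m0 by rewrite -sE mulrA divfK.
  apply: (mulfI s0); rewrite -phiM // sm phiM // -sE.
  by rewrite -[LHS]mulrA; congr (_ * _); rewrite mulrAC [RHS]mulrAC [m * _]mulrC.
have f_neq0 : phi m0 / m0 != 0.
  apply: mulf_neq0; last by rewrite invr_eq0.
  apply: contraNneq m0_neq0 => phi0; apply/eqP/phi_inj; rewrite ?inE //.
  by rewrite (phiE 0 M0) phi0 !mul0r.
exists (phi m0 / m0) => // m; split=> [Mm|]; first by rewrite -phiE //; exact: phiM'.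
by case/phi_surj => m' Mm'; rewrite phiE // => /(mulfI f_neq0) <-.
Qed.

(** The multiplier [f] sends [t^x0] into [T b] and [1 / f] sends [t^y0] into [T a], so both are
    Laurent polynomials and [f = c t^y]; this [y] is the translation. *)
Lemma divisorial_iso_translate a b x0 y0 :
  shifted_cone a x0 -> shifted_cone b y0 -> module_iso R (T a) (T b) ->
  exists y, forall x, shifted_cone a x <-> shifted_cone b (x + y).
Proof.
move=> ax0 by0 ab.
have [f f0 fP] := module_iso_mul (divisorial_submodule a)
  (monomial_divisorial ax0) (laurent_monomial_neq0 k x0) ab.
have setT_span c (g : K) : laurent_span (shifted_cone c) g -> laurent_span setT g.
  by move=> [x [p [-> _]]]; exists x, p.
have lm_span (x : 'rV[int]_D) : laurent_span setT (lm x).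
  by rewrite -[lm x]mul1r -tofrac1 -mpolyC1; exact: laurent_span_monomial.
have quo_span c (g : K) x : T c (g * lm x) -> laurent_span setT g.
  move=> /divisorial_span/setT_span gx.
  rewrite -[g](mulfK (laurent_monomial_neq0 k x)) -laurent_monomialN.
  exact: laurent_spanM (fun _ _ _ _ => I) gx (lm_span _).
have [|||c c0 [y fE]] := @laurent_unit k D f f^-1.
- apply: (quo_span b f x0); apply/(fP (lm x0)); exact: (monomial_divisorial ax0).
- apply: (quo_span a _ y0); apply/fP; rewrite mulVKf //.
  exact: monomial_divisorial.
- exact: divff.
exists y => x; split=> [ax|bx].
  apply: (laurent_monomial_span c0).
  rewrite laurent_monomialD [_ * lm y]mulrC mulrA -fE.
  by apply: divisorial_span; apply/(fP (lm x)); exact: monomial_divisorial.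
(* Since [f] sends [c^-1 t^x] to [t^(x + y)], membership is reflected back to [T a]. *)
have cV0 : c^-1 != 0 by rewrite invr_eq0.
apply: (laurent_monomial_span cV0); apply: divisorial_span; apply/fP.
rewrite fE mulrACA -tofracM -mpolyCM divff // mpolyC1 tofrac1 mul1r.
by rewrite -laurent_monomialD addrC; exact: monomial_divisorial.
Qed.

End Divisorial.

Lemma iso_class_eq (k : closedFieldType) (RR : realType) (D N : nat)
    (R : set (ratfun k D)) (v : 'M[int]_(N, D)) (M M' : set (ratfun k D)) :
  submodule R M -> submodule R M' -> module_iso R M M' ->
  iso_class RR R v M = iso_class RR R v M'.
Proof.
move=> subM subM' MM'; apply/seteqP; split=> P [divP iP]; split=> //.
  exact: module_iso_trans (module_iso_sym subM MM') iP.
exact: module_iso_trans MM' iP.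
Qed.

(** * The stable set ring: exponents, fractions and attained bounds *)

Lemma fraction_quotient (A : idomainType) (f : {fraction A}) :
  exists p q : A, q != 0 /\ f = tofrac p / tofrac q.
Proof.
elim/quotW: f => x; exists \n_x, \d_x; split; first exact: denom_ratioP.
have dx := denom_ratioP x.
apply: (canRL (mulfK _)); first by rewrite tofrac_eq0.
rewrite !piE; apply/eqmodP => /=.
rewrite FracField.equivfE /FracField.mulf !numden_Ratio ?oner_neq0 ?mulr1 ?mulf_neq0 //.
by rewrite mulrC.
Qed.

Lemma sum_mem (T : finType) (A B : {set T}) :
  \sum_(j in A) (j \in B)%:R = #|A :&: B|%:R :> int.
Proof.
rewrite -sum1_card natr_sum big_mkcond [RHS]big_mkcond.
by apply: eq_bigr => j _; rewrite inE; case: (j \in A); case: (j \in B).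
Qed.

Section StableSetRingFacts.
Variables (k : closedFieldType) (RR : realType) (d n : nat) (e : rel 'I_d).
Variable Q : 'I_n.+1 -> {set 'I_d}.
Hypothesis e_irr : irreflexive e.
Hypothesis Q_inj : injective Q.
Hypothesis Q_max : forall C : {set 'I_d}, maxset (clique e) C <-> exists i, C = Q i.
Local Notation K := (ratfun k (1 + d)).
Local Notation R := (stable_set_ring (k := k) e).
Local Notation v := (stab_gens Q).
Local Notation lm := (@laurent_monomial k (1 + d)).

Lemma sigma_intr (N D : nat) (w : 'M[int]_(N, D)) (x : 'rV[int]_D) :
  sigma w (map_mx intr x) = map_mx intr (sigma w x) :> 'rV[RR]_N.
Proof.
apply/rowP => i; rewrite !mxE rmorph_sum; apply: eq_bigr => j _.
by rewrite !mxE rmorphM /= intz.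
Qed.

Lemma shifted_coneE (N D : nat) (w : 'M[int]_(N, D)) (a : 'rV[int]_N) x :
  shifted_cone w (map_mx intr a : 'rV[RR]_N) x <-> forall i, a 0 i <= sigma w x 0 i.
Proof.
by split=> ax i; have := ax i; rewrite sigma_intr !mxE ler_int.
Qed.

Lemma sigma_clique (A : pzRingType) (x : 'rV[A]_(1 + d)) i :
  sigma v x 0 (lshift d i) = x 0 (lshift d 0) - \sum_(j in Q i) x 0 (rshift 1 j).
Proof. by rewrite sigma_stab row_mxEl mxE. Qed.

Lemma sigma_vertex (A : pzRingType) (x : 'rV[A]_(1 + d)) j :
  sigma v x 0 (rshift n.+1 j) = x 0 (rshift 1 j).
Proof. by rewrite sigma_stab row_mxEr mxE. Qed.

Lemma Q_clique i : clique e (Q i).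
Proof. by apply: maxsetp; apply/Q_max; exists i. Qed.

Lemma Q_nsub i l : i != l -> ~~ (Q i \subset Q l).
Proof.
move=> il; apply: contraNN il => sub.
have /maxsetP[_ maxQ] : maxset (clique e) (Q i) by apply/Q_max; exists i.
by apply/eqP/Q_inj/esym/maxQ => //; exact: Q_clique.
Qed.

Lemma stable_set_ring_subalgebra : subalgebra R.
Proof.
split=> [c|f g fR gR|f g fR gR] A [subA GA]; have [AC AD AM] := subA.
- exact: AC.
- by apply: AD; [apply: fR|apply: gR].
- by apply: AM; [apply: fR|apply: gR].
Qed.

Lemma stable_set_monomial (S : {set 'I_d}) :
  tofrac (\prod_(j in S) 'X_(rshift 1 j) * 'X_(lshift d 0) : {mpoly k[1 + d]}) =
  lm (row_mx 1 (\row_j (j \in S)%:R)).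
Proof.
rewrite /laurent_monomial big_split_ord /= big_ord1 row_mxEl mxE.
rewrite tofracM mulrC; congr (_ * _); rewrite rmorph_prod big_mkcond /=.
by apply: eq_bigr => j _; rewrite row_mxEr mxE; case: (j \in S).
Qed.

(** A stable set meets a clique in at most one vertex, so the clique forms are nonnegative on the
    generators. *)
Lemma stable_set_ring_span :
  R `<=` laurent_span (shifted_cone v (0 : 'rV[RR]_(n.+1 + d))).
Proof.
rewrite -(map_mx0 intr).
have lm_span c (x : 'rV[int]_(1 + d)) : (forall i, 0 <= sigma v x 0 i) ->
    laurent_span (shifted_cone v (map_mx intr 0 : 'rV[RR]_(n.+1 + d)))
      (tofrac c%:MP * lm x).
  by move=> x0; apply: laurent_span_monomial; apply/shifted_coneE => i; rewrite mxE.
apply: smallest_sub.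
  split=> [c|f g|f g]; last 2 first.
  - exact: laurent_spanD.
  - apply: laurent_spanM => x y /shifted_coneE x0 /shifted_coneE y0.
    apply/shifted_coneE => i; have := x0 i; have := y0 i.
    by rewrite /sigma mulmxDl !mxE => *; apply: addr_ge0.
  by rewrite -[tofrac _]mulr1 -laurent_monomial0; apply: lm_span => i;
    rewrite /sigma mul0mx mxE.
move=> _ [S stS ->]; rewrite stable_set_monomial -[lm _]mul1r -tofrac1 -mpolyC1.
apply: lm_span => i; case: (split_ordP i) => l ->.
  rewrite sigma_clique row_mxEl mxE subr_ge0.
  under eq_bigr do rewrite row_mxEr mxE.
  rewrite sum_mem (ler_nat _ _ 1%N).
  apply/card_le1_eqP => x y /setIP[xQ xS] /setIP[yQ yS]; apply/eqP.
  apply: contraT => xy.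
  have /forall_inP/(_ x xQ)/forall_inP/(_ y yQ) := Q_clique l.
  have /forall_inP/(_ x xS)/forall_inP/(_ y yS) := stS.
  by rewrite eq_sym xy => /negPf ->.
by rewrite sigma_vertex row_mxEr mxE; case: (_ \in _).
Qed.

Lemma stable_set_ring_X j : R (tofrac ('X_(rshift 1 j) * 'X_(lshift d 0))).
Proof.
apply: sub_gen_smallest; exists [set j]%SET; last by rewrite big_set1.
by apply/forall_inP => x /set1P->; apply/forall_inP => y /set1P->; rewrite e_irr.
Qed.

Lemma stable_set_ring_X0 : R (tofrac 'X_(lshift d 0)).
Proof.
apply: sub_gen_smallest; exists finset.set0; last by rewrite big_set0 mul1r.
by apply/forall_inP => x; rewrite inE.
Qed.

Lemma stable_set_ring_exp f m : R f -> R (f ^+ m).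
Proof.
have [RC _ RM] := stable_set_ring_subalgebra => Rf.
elim: m => [|m IH]; first by rewrite expr0 -tofrac1 -mpolyC1; exact: RC.
by rewrite exprS; exact: RM.
Qed.

(** The ring contains [t_0] and every [t_j t_0], so each variable in a monomial is absorbed by one
    factor [t_0]. *)
Lemma stable_set_ring_mul_poly (p : {mpoly k[1 + d]}) :
  exists N, R (tofrac 'X_(lshift d 0) ^+ N * tofrac p).
Proof.
have [RC RD RM] := stable_set_ring_subalgebra.
set t := tofrac _.
elim/mpolyind: p => [|c m p _ _ [N Np]].
  exists 0; rewrite tofrac0 mulr0 -tofrac0 -mpolyC0; exact: RC.
have [N' N'm] : exists N', R (t ^+ N' * tofrac 'X_[m]).
  rewrite mpolyXE_id rmorph_prod.
  elim/big_rec: _ => [|i f _ [N' IH]].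
    by exists 0; rewrite mul1r -tofrac1 -mpolyC1; exact: RC.
  exists (m i + N')%N; rewrite exprD mulrACA; apply: (RM) => //.
  rewrite rmorphXn -exprMn; apply: stable_set_ring_exp.
  case: (split_ordP i) => j ->; last first.
    by rewrite mulrC -tofracM; exact: stable_set_ring_X.
  by rewrite (ord1 j); apply: (RM); exact: stable_set_ring_X0.
exists (N + N')%N; rewrite tofracD -mul_mpolyC tofracM mulrDr; apply: RD.
  rewrite mulrCA; apply: (RM); first exact: RC.
  rewrite exprD -mulrA; apply: (RM) => //.
  by apply: stable_set_ring_exp; exact: stable_set_ring_X0.
rewrite (addnC N) exprD -mulrA; apply: (RM) => //.
by apply: stable_set_ring_exp; exact: stable_set_ring_X0.
Qed.

Lemma stable_set_ring_frac (f : K) :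
  exists r s, [/\ R r, R s, s != 0 & s * f = r].
Proof.
have [p [q [q0 fE]]] := fraction_quotient f.
have [RC _ RM] := stable_set_ring_subalgebra.
have [Np Rp] := stable_set_ring_mul_poly p.
have [Nq Rq] := stable_set_ring_mul_poly q.
set t := tofrac _ in Rp Rq.
have Rt m : R (t ^+ m) by apply: stable_set_ring_exp; exact: stable_set_ring_X0.
(* The crossed powers give both elements the same factor [t ^ (Np + Nq)], which cancels. *)
exists (t ^+ Nq * (t ^+ Np * tofrac p)), (t ^+ Np * (t ^+ Nq * tofrac q)).
have t0 : t != 0 by exact: tofracX_neq0.
split; [exact: RM|exact: RM| |].
  apply: mulf_neq0; first exact: expf_neq0.
  by apply: mulf_neq0; [exact: expf_neq0|rewrite tofrac_eq0].
rewrite fE -!mulrA mulrCA; congr (_ * (_ * _)).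
by rewrite mulrC divfK ?tofrac_eq0.
Qed.

(** This makes [a] recoverable from the exponents of [T a], as the minima of the [sigma_i]. *)
Lemma attain_sigma (c : 'I_n.+1 -> int) i : exists x : 'rV[int]_(1 + d),
  let a := row_mx (\row_i c i) 0 in
  (forall l, a 0 l <= sigma v x 0 l) /\ sigma v x 0 i = a 0 i.
Proof.
pose B := \sum_l `|c l|; have cB l : `|c l| <= B.
  by rewrite /B (bigD1 l) //= lerDl; apply: sumr_ge0.
have B0 : 0 <= B by apply: sumr_ge0.
case: (split_ordP i) => {i} i ->; last first.
  (* For a vertex form, a large [t_0] coordinate alone meets every clique bound. *)
  exists (row_mx (const_mx B) 0); split=> [l|]; last first.
    by rewrite sigma_vertex !row_mxEr !mxE.
  case: (split_ordP l) => {l} l ->; last by rewrite sigma_vertex !row_mxEr !mxE.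
  rewrite sigma_clique !row_mxEl !mxE big1 ?subr0 => [|j _].
    by have := cB l; lia.
  by rewrite row_mxEr mxE.
(* [x] is large on [Q i] and zero elsewhere; any other [Q l] misses a vertex of
   [Q i]. *)
pose M := 2 * B.
pose x : 'rV[int]_(1 + d) :=
  row_mx (const_mx (c i + M * #|Q i|%:Z)) (\row_j (M * (j \in Q i)%:R)).
have sx l : sigma v x 0 (lshift d l) = c i + M * #|Q i :\: Q l|%:Z.
  rewrite sigma_clique row_mxEl mxE.
  under eq_bigr do rewrite row_mxEr mxE.
  rewrite -mulr_sumr -addrA -mulrBr; congr (_ + _ * _).
  rewrite -(cardsID (Q l) (Q i)) PoszD.
  by rewrite sum_mem finset.setIC natz addrC addKr.
exists x; split=> [l|]; last first.
  by rewrite sx row_mxEl mxE finset.setDv cards0 mulr0 addr0.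
case: (split_ordP l) => {l} l ->; last first.
  rewrite sigma_vertex !row_mxEr !mxE; case: (_ \in _); rewrite ?mulr0 // mulr1.
  exact: mulr_ge0.
rewrite sx row_mxEl mxE; have [->|il] := eqVneq l i.
  by rewrite finset.setDv cards0 mulr0 addr0.
(* One vertex of [Q i] outside [Q l] contributes [M = 2 * B], which is at least [c l - c i]. *)
have : (0 < #|Q i :\: Q l|)%N.
  by rewrite card_gt0 finset.setD_eq0 Q_nsub // eq_sym.
by have := cB l; have := cB i; rewrite /M; nia.
Qed.

End StableSetRingFacts.

(** * The bijection between lattice points and conic classes *)

Lemma extend0_int (RR : realType) n (w : 'rV[int]_n) :
  extend0 (map_mx intr w : 'rV[RR]_n) = map_mx intr (row_mx (0 : 'rV_1) w).
Proof. by rewrite map_row_mx map_mx0. Qed.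

Theorem theorem1p3 (k : closedFieldType) (hk : [pchar k] =i pred0)
    (RR : realType) (d n : nat) (e : rel 'I_d)
    (e_sym : symmetric e) (e_irr : irreflexive e) (e_perf : perfect e)
    (Q : 'I_n.+1 -> {set 'I_d}) (Q_inj : injective Q)
    (Q_max : forall C : {set 'I_d},
       maxset (clique e) C <-> exists i, C = Q i) :
  let R := stable_set_ring (k := k) e in
  let v := stab_gens Q in
  set_bij
    (conic_region Q `&` [set z | z \is a mxOver Num.int])
    (conic_classes RR R v)
    (fun z : 'rV[RR]_n =>
       iso_class RR R v
         (divisorial_module R v (row_mx (extend0 z) (0 : 'rV[RR]_d)))).
Proof.
move=> R v.
have int_vec (z : 'rV[RR]_n) : z \is a mxOver Num.int ->
    exists w : 'rV[int]_n, z = map_mx intr w.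
  move=> /mxOverP zint; exists (map_mx Num.floor z).
  by apply/rowP => i; rewrite !mxE floorK.
pose a (w : 'rV[int]_n) : 'rV[int]_(n.+1 + d) := row_mx (row_mx (0 : 'rV_1) w) 0.
pose ar w : 'rV[RR]_(n.+1 + d) := map_mx intr (a w).
have aE w : row_mx (extend0 (map_mx intr w)) 0 = ar w.
  by rewrite /ar extend0_int [RHS]map_row_mx map_mx0.
have regionE (w : 'rV[int]_n) : conic_region Q (map_mx intr w : 'rV[RR]_n) <->
    int_region Q (fun i => (row_mx (0 : 'rV_1) w) 0 i).
  by apply: conic_region_int => i; rewrite extend0_int mxE.
have subT (b : 'rV[RR]_(n.+1 + d)) := divisorial_submodule R v b.
have row_id (c : 'rV[int]_n.+1) : \row_i c 0 i = c by apply/rowP => i; rewrite mxE.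
split.
- move=> z [zC /int_vec[w zw]]; subst z; rewrite aE.
  have /regionE/int_region_cost_gt0 cost := zC.
  have [|x xP] := @exists_ceil_sigma RR _ _ v (a w).
    by move=> y y0 yv; have := cost y y0 yv; rewrite row_id.
  exists (divisorial_module R v (ar w)) => //; split; first by exists (ar w).
  exists x; suff -> : map_mx (fun r => (Num.ceil r)%:~R) (sigma v x) = ar w.
    exact: module_iso_refl.
  by apply/rowP => i; rewrite /ar [LHS]mxE xP [RHS]mxE.
- move=> z z' /[!inE] -[_ /int_vec[w zw]] [_ /int_vec[w' zw']]; subst z z'.
  rewrite !aE -/(ar w) -/(ar w') => E.
  have iso : module_iso R (divisorial_module R v (ar w))
      (divisorial_module R v (ar w')).
    suff [] : iso_class RR R v (divisorial_module R v (ar w))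
        (divisorial_module R v (ar w')) by [].
    rewrite E; split; last exact: module_iso_refl.
    by exists (ar w').
  have attain (u : 'rV[int]_n) i : exists x, shifted_cone v (ar u) x
      /\ sigma v x 0 i = a u 0 i.
    have [x /= []] := attain_sigma Q_inj Q_max (fun i => (row_mx (0 : 'rV_1) u) 0 i) i.
    by rewrite row_id => xP xi; exists x; split=> //; apply/shifted_coneE.
  have [x0 [x0P _]] := attain w (lshift d 0).
  have [y0 [y0P _]] := attain w' (lshift d 0).
  have [y yP] := divisorial_iso_translate (stable_set_ring_span (k := k) RR Q_max)
    (stable_set_ring_frac (k := k) e_irr) x0P y0P iso.
  (* Translation by [y] identifies the two sets of exponents, so the minima of [sigma_i], attained
     on both, differ by [sigma_i y]. *)
  have shift i : a w' 0 i = a w 0 i + sigma v y 0 i.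
    apply/le_anti/andP; split.
      have [x [/yP/shifted_coneE/(_ i) + <-]] := attain w i.
      by rewrite sigmaD [leRHS]mxE.
    have [x [xP <-]] := attain w' i.
    have /yP/shifted_coneE/(_ i) : shifted_cone v (ar w') (x - y + y).
      by rewrite subrK.
    by rewrite -lerBrDr => /le_trans; apply; rewrite sigmaD sigmaN mxE lerD2l mxE.
  (* The vertex entries and entry 0 of both vectors are 0, which forces [y] to vanish. *)
  have y_vertex j : y 0 (rshift 1 j) = 0.
    have := shift (rshift n.+1 j).
    by rewrite sigma_vertex !row_mxEr !mxE add0r => <-.
  have sigma_y i : sigma v y 0 (lshift d i) = y 0 (lshift d 0).
    by rewrite sigma_clique big1 ?subr0.
  have y0E : y 0 (lshift d 0) = 0.
    have := shift (lshift d (lshift n (0 : 'I_1))).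
    by rewrite sigma_y !row_mxEl !(@row_mxEl _ 1 1 n) !mxE add0r => <-.
  congr (map_mx _ _); apply/rowP => i.
  have := shift (lshift d (rshift 1 i)).
  by rewrite sigma_y y0E addr0 !row_mxEl !(@row_mxEr _ 1 1 n).
- move=> _ [M [divM [x Mx]] <-].
  (* Subtracting [y1] brings the vertex coordinates of [x] into [(-1, 0]]; [y0] is then chosen so
     that the round-up of [sigma_0] becomes 0, the normalisation [z_0 = 0]. *)
  pose y1 : 'rV[int]_d := \row_j Num.ceil (x 0 (rshift 1 j)).
  pose x1 : 'rV[RR]_d := \row_j (x 0 (rshift 1 j) - (y1 0 j)%:~R).
  pose y0 := Num.ceil (x 0 (lshift d 0) - \sum_(j in Q 0) x1 0 j).
  pose y : 'rV[int]_(1 + d) := row_mx (const_mx y0) y1.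
  pose x' := x - map_mx intr y.
  pose c i := Num.ceil (x' 0 (lshift d 0) - \sum_(j in Q i) x' 0 (rshift 1 j)).
  have x'_vertex j : x' 0 (rshift 1 j) = x1 0 j.
    by rewrite 3!mxE row_mxEr [RHS]mxE.
  have ceil_x' j : Num.ceil (x' 0 (rshift 1 j)) = 0.
    by rewrite x'_vertex !mxE -rmorphN ceilDrz ?intr_int // intrKceil subrr.
  have x'_0 : x' 0 (lshift d 0) = x 0 (lshift d 0) - y0%:~R.
    by rewrite 3!mxE row_mxEl mxE.
  have c0 : c 0 = 0.
    rewrite /c x'_0 (eq_bigr (fun j => x1 0 j)) // addrAC -rmorphN.
    by rewrite ceilDrz ?intr_int // intrKceil subrr.
  pose w : 'rV[int]_n := \row_i c (rshift 1 i).
  have cw i : row_mx (0 : 'rV_1) w 0 i = c i.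
    case: (split_ordP i) => j ->; last by rewrite row_mxEr mxE.
    by rewrite row_mxEl mxE (ord1 j) -[LHS]c0; congr c; exact: val_inj.
  exists (map_mx intr w).
    split; last by apply/mxOverP => i j; rewrite mxE; exact: intr_int.
    apply/regionE; rewrite (_ : (fun i => _) = c); last exact/funext.
    exact: ceil_int_region.
  rewrite aE; apply: iso_class_eq => //; first by case: divM => b ->.
  apply: module_iso_sym; first by case: divM => b ->.
  apply: module_iso_trans Mx _.
  apply: module_iso_sym; first exact: subT.
  (* As [x = x' + y] with [y] integral, rounding up commutes with adding [sigma y]. *)
  have -> : map_mx (fun r => (Num.ceil r)%:~R) (sigma v x) =
      ar w + sigma v (map_mx intr y).
    have sx i : sigma v x 0 i = sigma v x' 0 i + (sigma v y 0 i)%:~R.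
      rewrite -[x in LHS](subrK (map_mx intr y)) sigmaD sigma_intr [LHS]mxE.
      by rewrite [X in _ + X = _]mxE.
    apply/rowP => i; rewrite sigma_intr [LHS]mxE [RHS]mxE sx.
    rewrite ceilDrz ?intr_int // intrKceil rmorphD /=.
    rewrite [X in _ = X + _]mxE [X in _ = _ + X]mxE; congr (_%:~R + _).
    case: (split_ordP i) => j ->; last by rewrite sigma_vertex ceil_x' row_mxEr mxE.
    by rewrite sigma_clique row_mxEl cw.
  exact: divisorial_translate.
Qed.
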